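(* Let $m$ and $n$ be nonnegative integers with $m\le n$. Then $$\sum_{k=m}^n \frac{2^{-2k}C_kO_{k-m}}{\prod_{j=1}^m\bigl(2(k-j)+1\bigr)} + \sum_{k=0}^m \frac{2^{-2k}C_kO_{m-k}}{\prod_{j=1}^m\bigl(2(k-j)+1\bigr)}$$ $$= \frac{(-1)^m2^{m+2}}{(m+2)!}\,\frac{O_{m+1}}{C_{m+1}} - \frac{2^{m-2n}}{m!\,(2m+1)}\,\frac{C_{n-m}}{\binom{n+1}{m}}\Big(\bigl(2(n-m)+1\bigr)O_{n-m}+\frac{2(n+1)}{2m+1}\Big).$$
   Context: $C_n=\frac{1}{n+1}\binom{2n}{n}$, $n\ge 0$, are the Catalan numbers. $O_n=\sum_{k=1}^n\frac{1}{2k-1}$ are the odd harmonic numbers, with $O_0=0$. Empty products equal $1$. *)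

(* Defs.v *)
From mathcomp Require Import all_boot all_order all_algebra.

Set Implicit Arguments.
Unset Strict Implicit.
Unset Printing Implicit Defensive.

Import GRing.Theory.

Local Open Scope ring_scope.

(* Rational-valued, so that the defining quotient is an exact division. *)
Definition catalan (n : nat) : rat := n.+1%:R^-1 * 'C(2 * n, n)%:R.

Definition odd_harmonic (n : nat) : rat :=
  \sum_(1 <= k < n.+1) (2 * k%:R - 1)^-1.

(* Main.v *)
(** Put [w k = 4^-k C_k / prod_(1 <= j <= m) (2 (k - j) + 1)] and
    [T k = - 2 (k + 1) w k / (2 m + 1)].  The ratio
    [w (k + 1) / w k = (2 (k - m) + 1) / (2 (k + 2))] gives
    [T (k + 1) - T k = w k], and then summation by parts shows that
    [w k O_|k - m|] is the increment of [U k = T k (O_|k - m| + 1 / (2 m + 1))].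
    This holds both for [k >= m] and for [k < m], so the two sums telescope to
    [(U (n + 1) - U m) + (U m - U 0)], whose end values are explicit. *)
Require Import Defs.
From mathcomp Require Import all_boot all_order all_algebra.
From mathcomp Require Import ring zify.

Import GRing.Theory Num.Theory.

Local Open Scope ring_scope.

Definition odd_prod (m : nat) (x : rat) : rat :=
  \prod_(1 <= j < m.+1) (2 * (x - j%:R) + 1).

Definition weight (m k : nat) : rat :=
  2 ^- (2 * k) * catalan k / odd_prod m k%:R.

Definition weight_sum (m k : nat) : rat :=
  - (2 * k.+1%:R / (2 * m%:R + 1)) * weight m k.

(** Odd integers are nonzero; [z] ranges over [int] because the factors [2 (k - j) + 1] are negative
    for [k < j]. *)
Lemma odd_neq0 (z : int) : 2 * z%:~R + 1 != 0 :> rat.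
Proof.
have -> : 2 * z%:~R + 1 = (2 * z + 1)%:~R :> rat by rewrite intrD intrM.
by rewrite intr_eq0; lia.
Qed.

Lemma odd_nat_neq0 (k : nat) : 2 * k%:R + 1 != 0 :> rat.
Proof. exact: (odd_neq0 k%:Z). Qed.

Lemma odd_sub_neq0 (k j : nat) : 2 * (k%:R - j%:R) + 1 != 0 :> rat.
Proof. by have := odd_neq0 (k%:Z - j%:Z); rewrite intrB. Qed.

Lemma natS_neq0 (k : nat) : k.+1%:R != 0 :> rat.
Proof. by rewrite pnatr_eq0. Qed.

Lemma catalan0 : catalan 0 = 1.
Proof. by rewrite /catalan muln0 bin0 invr1 mulr1. Qed.

Lemma catalanS (k : nat) :
  k.+2%:R * catalan k.+1 = 2 * (2 * k%:R + 1) * catalan k.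
Proof.
(* The central binomial recurrence, obtained by passing through ['C(2 * k + 1, k)]. *)
have e : (k.+1 * 'C(2 * k.+1, k.+1) = 2 * (2 * k + 1) * 'C(2 * k, k))%N.
  have h1 := mul_bin_diag (2 * k.+1) k; have h2 := mul_bin_down (2 * k).+1 k.
  rewrite (_ : (2 * k.+1).-1 = (2 * k).+1)%N in h1; last by lia.
  rewrite /= (_ : (2 * k).+1 - k = k.+1)%N in h2; last by lia.
  by nia.
rewrite /catalan mulrA divff ?natS_neq0 // mul1r.
apply: (mulfI (natS_neq0 k)); rewrite -[LHS]natrM e !natrM natrD natrM.
by field; rewrite nat1r natS_neq0.
Qed.

Lemma catalan_neq0 (k : nat) : catalan k != 0.
Proof.
by rewrite /catalan mulf_neq0 ?invr_neq0 ?natS_neq0 // pnatr_eq0 -lt0n bin_gt0; lia.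
Qed.

Lemma odd_harmonicS (k : nat) :
  odd_harmonic k.+1 = odd_harmonic k + (2 * k%:R + 1)^-1.
Proof.
rewrite /odd_harmonic big_nat_recr //=; congr (_ + _^-1).
by rewrite -natr1; ring.
Qed.

Lemma odd_harmonic0 : odd_harmonic 0 = 0.
Proof. by rewrite /odd_harmonic big_geq. Qed.

Lemma odd_prodS (m : nat) (x : rat) :
  odd_prod m.+1 x = odd_prod m x * (2 * (x - m.+1%:R) + 1).
Proof. by rewrite /odd_prod big_nat_recr. Qed.

Lemma odd_prod0 (x : rat) : odd_prod 0 x = 1.
Proof. by rewrite /odd_prod big_geq. Qed.

Lemma odd_prod_neq0 (m k : nat) : odd_prod m k%:R != 0.
Proof.
elim: m => [|m IHm]; first by rewrite odd_prod0 oner_neq0.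
by rewrite odd_prodS mulf_neq0 // odd_sub_neq0.
Qed.

(** Both sides are the product of [2 (x - j) + 1] over [0 <= j <= m]. *)
Lemma odd_prod_shift (m : nat) (x : rat) :
  odd_prod m (x + 1) * (2 * (x - m%:R) + 1) = odd_prod m x * (2 * x + 1).
Proof.
elim: m => [|m IHm]; first by rewrite !odd_prod0 subr0.
rewrite !odd_prodS [RHS]mulrAC -IHm -natr1; ring.
Qed.

(** The factor [2 k + 1] from the Catalan recurrence cancels the one produced by shifting the
    product. *)
Lemma weightSr (m k : nat) :
  2 * k.+2%:R * weight m k.+1 = (2 * (k%:R - m%:R) + 1) * weight m k.
Proof.
have h := odd_prod_shift m k%:R; rewrite natr1 in h.
have hc := catalanS k.
have p0 := odd_prod_neq0 m k; have p1 := odd_prod_neq0 m k.+1.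
have hp : (odd_prod m k.+1%:R)^-1 * (2 * k%:R + 1)
        = (odd_prod m k%:R)^-1 * (2 * (k%:R - m%:R) + 1).
  apply: (mulfI p0); apply: (mulfI p1).
  by rewrite mulrCA (mulVKf p1) (mulVKf p0) h.
rewrite /weight mulnS exprD invfM.
transitivity (2^-1 * 2 ^- (2 * k) * (k.+2%:R * catalan k.+1) / odd_prod m k.+1%:R).
  by rewrite expr2; field; rewrite p1 expf_neq0.
rewrite hc.
transitivity (2 ^- (2 * k) * catalan k * ((odd_prod m k.+1%:R)^-1 * (2 * k%:R + 1))).
  by field; rewrite p1 expf_neq0.
by rewrite hp; ring.
Qed.

(** Only the factor [j = m + 1] is new; this drives the inductions on [m] that give the end
    values. *)
Lemma weightSl (m k : nat) :
  weight m.+1 k * (2 * (k%:R - m.+1%:R) + 1) = weight m k.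
Proof.
rewrite /weight odd_prodS invfM -!mulrA mulVf ?mulr1 //.
exact: odd_sub_neq0.
Qed.

Lemma weight_sumS (m k : nat) :
  weight_sum m k.+1 = - (2 * (k%:R - m%:R) + 1) / (2 * m%:R + 1) * weight m k.
Proof.
transitivity (- (2 * k.+2%:R * weight m k.+1) / (2 * m%:R + 1)).
  by rewrite /weight_sum; ring.
by rewrite weightSr; ring.
Qed.

(** The error term of the summation by parts is again a multiple of [weight m k], so adding a
    constant to the harmonic number absorbs it. *)
Lemma weight_sumS_div (m k : nat) :
  weight_sum m k.+1 / (2 * (k%:R - m%:R) + 1)
  = - (weight m k / (2 * m%:R + 1)).
Proof.
by rewrite weight_sumS; field; rewrite odd_nat_neq0 odd_sub_neq0.
Qed.

Lemma weight_sumB (m k : nat) :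
  weight_sum m k.+1 - weight_sum m k = weight m k.
Proof.
by rewrite weight_sumS /weight_sum -natr1; field; exact: odd_nat_neq0.
Qed.

(** A diagonal step raises [m], then [k]. Both odd factors met on the way are [1], so it only
    divides by [2 (m + 2)]. *)
Lemma weight_diag (m : nat) : weight m m = 2 ^- m / (m.+1)`!%:R.
Proof.
elim: m => [|m IHm].
  by rewrite /weight catalan0 odd_prod0.
have := weightSl m m.+1; rewrite subrr mulr0 add0r mulr1 => ->.
apply: (mulfI (mulf_neq0 _ (natS_neq0 m.+1) : 2 * m.+2%:R != 0)) => //.
rewrite weightSr IHm subrr mulr0 add0r mul1r (factS m.+1) natrM exprS.
have f0 : (m.+1)`!%:R != 0 :> rat by rewrite pnatr_eq0 -lt0n fact_gt0.
by field; rewrite f0 -natrD pnatr_eq0 expf_neq0.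
Qed.

(** Evaluates the upper end, with [d = n - m], by induction from the diagonal. *)
Lemma weight_add (m d : nat) :
  weight m (m + d)
  = 2 ^+ m / 2 ^+ (2 * (m + d)) / m`!%:R * (catalan d / 'C((m + d).+1, m)%:R).
Proof.
have f0 : m`!%:R != 0 :> rat by rewrite pnatr_eq0 -lt0n fact_gt0.
elim: d => [|d IHd].
  rewrite addn0 weight_diag catalan0 binSn factS natrM mul2n -addnn exprD.
  by field; rewrite f0 nat1r natS_neq0 expf_neq0.
have b0 (e : nat) : 'C((m + e).+1, m)%:R != 0 :> rat.
  by rewrite pnatr_eq0 -lt0n bin_gt0; lia.
apply: (mulfI (mulf_neq0 _ (natS_neq0 (m + d).+1) : 2 * (m + d).+2%:R != 0)) => //.
rewrite addnS weightSr IHd.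
have hb : (m + d).+2%:R * 'C((m + d).+1, m)%:R
        = d.+2%:R * 'C((m + d).+2, m)%:R :> rat.
  rewrite -!natrM; congr _%:R; rewrite (mul_bin_down (m + d).+2 m).
  by congr (_ * _)%N; lia.
have hc := catalanS d.
have := b0 d.+1; rewrite addnS => b2.
have -> : 'C((m + d).+1, m)%:R
        = d.+2%:R * 'C((m + d).+2, m)%:R / (m + d).+2%:R :> rat.
  by rewrite -hb mulrAC divff ?mul1r ?natS_neq0.
have -> : catalan d.+1 = 2 * (2 * d%:R + 1) * catalan d / d.+2%:R.
  by rewrite -hc mulrAC divff ?mul1r ?natS_neq0.
have -> : (m + d)%:R - m%:R = d%:R :> rat by rewrite natrD addrC addKr.
rewrite mulnS exprD expr2.
by field; rewrite b2 f0 expf_neq0 // -!natrD !pnatr_eq0.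
Qed.

(** Evaluates the lower end: at [k = 0] the new factor is [- (2 m + 1)], and the Catalan recurrence
    turns the resulting odd product into [catalan m.+1]. *)
Lemma weight_sum0 (m : nat) :
  weight_sum m 0 = - ((-1) ^+ m * 2 ^+ (m + 2) / ((m + 2)`!%:R * catalan m.+1)).
Proof.
rewrite /weight_sum mulNr; congr (- _); rewrite mulr1 addn2.
elim: m => [|m IHm].
  have c1 : catalan 1 = 1 by rewrite /catalan.
  by rewrite /weight c1 catalan0 odd_prod0.
have hw : weight m.+1 0 = - (2 * m%:R + 1)^-1 * weight m 0.
  rewrite -(weightSl m 0) -natr1 sub0r.
  by field; exact: odd_nat_neq0.
have f0 : (m.+2)`!%:R != 0 :> rat by rewrite pnatr_eq0 -lt0n fact_gt0.
have c0 := catalan_neq0 m.+1.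
have hc := catalanS m.+1.
transitivity (- (2 / (2 * m.+1%:R + 1)) * (2 / (2 * m%:R + 1) * weight m 0) / 2).
  by rewrite hw; field; rewrite odd_nat_neq0 -[1 + m%:R]/(1%:R + m%:R) -natrD odd_nat_neq0.
rewrite IHm (factS m.+2) natrM.
rewrite [_ * catalan m.+2](_ : _ = (m.+2)`!%:R * (m.+3%:R * catalan m.+2)); last by ring.
rewrite hc !exprS.
move: (odd_nat_neq0 m.+1); move: (m.+1%:R : rat) => u u0.
by field; rewrite f0 c0 u0.
Qed.

(* One of the two truncated differences vanishes, so their sum is [|k - m|]. *)
Definition primitive (m k : nat) : rat :=
  weight_sum m k * (odd_harmonic (k - m + (m - k))%N + (2 * m%:R + 1)^-1).

Lemma primitive_upper (m k : nat) : (m <= k)%N ->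
  weight m k * odd_harmonic (k - m) = primitive m k.+1 - primitive m k.
Proof.
move=> le_mk; rewrite /primitive.
have [-> ->] : (m - k = 0 /\ m - k.+1 = 0)%N by lia.
rewrite !addn0 subSn // odd_harmonicS natrB //.
rewrite -[weight m k in LHS]weight_sumB.
have w2 := weight_sumB m k.
have e := weight_sumS_div m k.
set i := (2 * (k%:R - m%:R) + 1)^-1 in e *; set o := odd_harmonic _.
(* The second bracket is zero by [e]: the harmonic increment [i] is offset by the constant
   [1 / (2 m + 1)]. *)
transitivity ((weight_sum m k.+1 - weight_sum m k) * o
  + (weight_sum m k.+1 * i + weight m k / (2 * m%:R + 1))).
  by rewrite e addNr addr0.
by rewrite -w2; ring.
Qed.

Lemma primitive_lower (m k : nat) : (k < m)%N ->
  weight m k * odd_harmonic (m - k) = primitive m k.+1 - primitive m k.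
Proof.
move=> lt_km; rewrite /primitive.
have [-> ->] : (k - m = 0 /\ k.+1 - m = 0)%N by lia.
rewrite !add0n.
have -> : (m - k = (m - k.+1).+1)%N by lia.
rewrite odd_harmonicS natrB // -[k.+1%:R]natr1.
have w2 := weight_sumB m k.
set o := odd_harmonic _.
(* The index now decreases, but the denominator changes sign too, so the increment of the harmonic
   number is [i] as in the upper range. *)
have -> : 2 * (m%:R - (k%:R + 1)) + 1 = - (2 * (k%:R - m%:R) + 1) :> rat by ring.
have e := weight_sumS_div m k.
rewrite invrN.
have -> : weight_sum m k = weight_sum m k.+1 - weight m k by rewrite -w2; ring.
set i := (2 * (k%:R - m%:R) + 1)^-1 in e *.
transitivity (weight m k * (o - i)
  + (weight_sum m k.+1 * i + weight m k / (2 * m%:R + 1))).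
  by rewrite e addNr addr0.
by ring.
Qed.

Theorem proposition2 (m n : nat) (le_mn : (m <= n)%N) :
  \sum_(m <= k < n.+1)
      (2 ^- (2 * k) * catalan k * odd_harmonic (k - m)%N
       / \prod_(1 <= j < m.+1) (2 * (k%:R - j%:R) + 1))
  + \sum_(0 <= k < m.+1)
      (2 ^- (2 * k) * catalan k * odd_harmonic (m - k)%N
       / \prod_(1 <= j < m.+1) (2 * (k%:R - j%:R) + 1))
  = (-1) ^+ m * 2 ^+ (m + 2) / ((m + 2)`!)%:R
      * (odd_harmonic m.+1 / catalan m.+1)
    - 2 ^ (m%:Z - (2 * n)%:Z) / ((m`!)%:R * (2 * m%:R + 1))
      * (catalan (n - m)%N / 'C(n.+1, m)%:R)
      * ((2 * (n - m)%N%:R + 1) * odd_harmonic (n - m)%N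
         + 2 * n.+1%:R / (2 * m%:R + 1))
  :> rat.
Proof.
have upper : \sum_(m <= k < n.+1)
    (2 ^- (2 * k) * catalan k * odd_harmonic (k - m)%N
     / \prod_(1 <= j < m.+1) (2 * (k%:R - j%:R) + 1))
  = primitive m n.+1 - primitive m m.
  apply: telescope_sumr_eq; first exact: leqW.
  by move=> k /andP[le_mk _]; rewrite -primitive_upper // mulrAC.
have lower : \sum_(0 <= k < m.+1)
    (2 ^- (2 * k) * catalan k * odd_harmonic (m - k)%N
     / \prod_(1 <= j < m.+1) (2 * (k%:R - j%:R) + 1))
  = primitive m m - primitive m 0.
  (* The term [k = m] vanishes since [O_0 = 0], which leaves the range [k < m]. *)
  rewrite big_nat_recr //= subnn odd_harmonic0 mulr0 mul0r addr0.
  apply: telescope_sumr_eq => // k /andP[_ lt_km].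
  by rewrite -primitive_lower // mulrAC.
rewrite upper lower addrA subrK addrC.
have m0 := odd_nat_neq0 m.
congr (_ + _).
  (* At [k = 0] the constant [1 / (2 m + 1)] completes [O_m] to [O_(m+1)]. *)
  rewrite /primitive sub0n add0n subn0 weight_sum0 -odd_harmonicS invfM; ring.
rewrite /primitive (_ : m - n.+1 = 0)%N; last by lia.
(* The factor [2 (n - m) + 1] from [weight_sumS] multiplies the harmonic bracket; its non-harmonic
   part becomes [1 + (2 (n - m) + 1) / (2 m + 1) = 2 (n + 1) / (2 m + 1)]. *)
rewrite addn0 subSn // odd_harmonicS weight_sumS.
have := weight_add m (n - m); rewrite subnKC // => ->.
have -> : 2 ^ (m%:Z - (2 * n)%:Z) = 2 ^+ m / 2 ^+ (2 * n) :> rat.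
  by rewrite expfzDr // -exprnN.
have k0 := odd_nat_neq0 (n - m).
have -> : n%:R - m%:R = (n - m)%:R :> rat by rewrite natrB.
have -> : n.+1%:R = (n - m)%:R + m%:R + 1 :> rat by rewrite -natrD subnK // natr1.
have b0 : 'C(n.+1, m)%:R != 0 :> rat.
  by rewrite pnatr_eq0 -lt0n bin_gt0 leqW.
have f0 : m`!%:R != 0 :> rat by rewrite pnatr_eq0 -lt0n fact_gt0.
by field; rewrite m0 b0 f0 k0 expf_neq0.
Qed.
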